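(* Let $\mathcal H$ be a complex Hilbert space of finite dimension $d\ge 2$. A context-indexed probability assignment on the set $\mathfrak M(\mathcal H)$ of all projective measurements is context independent if and only if it is refinement consistent.
   Context: A projective measurement on $\mathcal H$ is an unordered finite family (set) $\mathsf M=\{P_1,\dots,P_m\}$ of nonzero pairwise orthogonal orthogonal projections on $\mathcal H$ with $\sum_{j=1}^m P_j=I$; $\mathfrak M(\mathcal H)$ is the set of all of them. A context-indexed probability assignment on $\mathfrak M(\mathcal H)$ is a function $w:\{(P,\mathsf M):\mathsf M\in\mathfrak M(\mathcal H),\ P\in\mathsf M\}\to[0,1]$ with $\sum_{P\in\mathsf M}w(P,\mathsf M)=1$ for every $\mathsf M$. It is context independent if $w(P,\mathsf M)=w(P,\mathsf N)$ whenever $P\in\mathsf M\cap\mathsf N$. A measurement $\mathsf M'$ is an elementary refinement of $\mathsf M$ if there are an outcome $Q\in\mathsf M$ and nonzero orthogonal projections $Q_1,Q_2$ (mutually orthogonal) with $Q=Q_1+Q_2$ and $\mathsf M'=(\mathsf M\setminus\{Q\})\cup\{Q_1,Q_2\}$. If $P\in\mathsf M\setminus\{Q\}$, write $\mathsf M'\succ_P\mathsf M$ (elementary complementary refinement relative to $P$). The assignment $w$ is refinement consistent if $w(P,\mathsf M')=w(P,\mathsf M)$ whenever $\mathsf M'\succ_P\mathsf M$. *)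

(* Defs.v *)
From mathcomp Require Import all_boot all_order all_algebra finmap reals complex.
Import Order.TTheory GRing.Theory Num.Theory Num.Def.

Set Implicit Arguments.
Unset Strict Implicit.
Unset Printing Implicit Defensive.

Local Open Scope fset_scope.
Local Open Scope ring_scope.

(* A complex Hilbert space of finite dimension is a [vectType R[i]], with
   [R : realType], carrying a positive definite Hermitian form [ip]; it is
   linear in its first argument and conjugate-linear in its second.
   Completeness is automatic in finite dimension. *)

Definition is_oproj (R : realType) (H : vectType R[i])
    (ip : {dot H for @conjC R[i]}) (P : 'End(H)) : Prop :=
  (P \o P)%VF = P /\ forall u v : H, ip (P u) v = ip u (P v).

Record measurement (R : realType) (H : vectType R[i])
    (ip : {dot H for @conjC R[i]}) := Measurement {
  outcomes :> {fset 'End(H)};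
  measurement_oproj : forall P, P \in outcomes -> is_oproj ip P;
  measurement_neq0 : forall P, P \in outcomes -> P <> 0;
  measurement_orth : forall P Q, P \in outcomes -> Q \in outcomes ->
    P <> Q -> (P \o Q)%VF = 0;
  measurement_sum : \sum_(P <- outcomes) P = \1%VF }.

(* The domain of an assignment is the dependent sum of the finite types
   [outcomes M], so the pairs (P, M) with P in M and nothing else;
   [[` PM]] is the element of that finite type given by [PM : P \in M]. *)
Record assignment (R : realType) (H : vectType R[i])
    (ip : {dot H for @conjC R[i]}) := Assignment {
  assignment_fun :> forall M : measurement ip, outcomes M -> R;
  assignment_ge0_le1 : forall M P, 0 <= @assignment_fun M P <= 1;
  assignment_sum : forall M, \sum_(P : outcomes M) @assignment_fun M P = 1 }.

Definition context_independent (R : realType) (H : vectType R[i])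
    (ip : {dot H for @conjC R[i]}) (w : assignment ip) : Prop :=
  forall (M N : measurement ip) (P : 'End(H))
    (PM : P \in outcomes M) (PN : P \in outcomes N), w M [` PM] = w N [` PN].

Definition elementary_refinement_at (R : realType) (H : vectType R[i])
    (ip : {dot H for @conjC R[i]}) (Q : 'End(H)) (M' M : measurement ip) :
    Prop :=
  Q \in outcomes M /\
  exists Q1 Q2 : 'End(H),
    [/\ is_oproj ip Q1 /\ is_oproj ip Q2,
        Q1 <> 0 /\ Q2 <> 0,
        (Q1 \o Q2)%VF = 0,
        Q = Q1 + Q2
      & outcomes M' = (outcomes M `\ Q) `|` [fset Q1; Q2]].

Definition complementary_refinement (R : realType) (H : vectType R[i])
    (ip : {dot H for @conjC R[i]}) (P : 'End(H)) (M' M : measurement ip) :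
    Prop :=
  exists Q : 'End(H),
    elementary_refinement_at Q M' M /\ P \in outcomes M `\ Q.

Definition refinement_consistent (R : realType) (H : vectType R[i])
    (ip : {dot H for @conjC R[i]}) (w : assignment ip) : Prop :=
  forall (M' M : measurement ip) (P : 'End(H)),
    complementary_refinement P M' M ->
    forall (PM' : P \in outcomes M') (PM : P \in outcomes M),
      w M' [` PM'] = w M [` PM].

(* Main.v *)
Require Import Defs.
From mathcomp Require Import all_boot all_order all_algebra finmap reals complex.
From mathcomp Require boolp.
Import Order.TTheory GRing.Theory Num.Theory Num.Def.

Local Open Scope ring_scope.

(** Merging two outcomes other than [P] yields a measurement of which the given
    one is an elementary refinement relative to [P].  Iterating, refinement
    consistency reduces [w M P] to the case where [M] has at most one outcome
    besides [P]; such an [M] consists of the nonzero ones among [P] and [1 - P],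
    so it depends on [P] alone. *)

Section Measurements.

Set Implicit Arguments.
Unset Strict Implicit.
Local Open Scope fset_scope.
Local Open Scope ring_scope.

Context {R : realType} {H : vectType R[i]} {ip : {dot H for @conjC R[i]}}.
Implicit Types (M N : measurement ip) (P Q : 'End(H)).

Lemma is_oprojD P Q : is_oproj ip P -> is_oproj ip Q ->
  (P \o Q)%VF = 0 -> (Q \o P)%VF = 0 -> is_oproj ip (P + Q).
Proof.
move=> [PP Pip] [QQ Qip] PQ QP; split=> [|u v].
  by rewrite comp_lfunDl !comp_lfunDr PP QQ PQ QP addr0 add0r.
by rewrite !add_lfunE linearDl linearDr /= Pip Qip.
Qed.

(** A value of [w] is indexed by the whole record, proofs included. The other fields are
    propositions, so proof irrelevance leaves only the outcome set to compare. *)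
Lemma measurement_inj M N : outcomes M = outcomes N -> M = N.
Proof.
case: M N => [A a1 a2 a3 a4] [B b1 b2 b3 b4] /= AB; case: _ / AB b1 b2 b3 b4.
by move=> *; congr Measurement; exact: boolp.Prop_irrelevance.
Qed.

Lemma eq_assignment (w : assignment ip) M N P
    (PM : P \in outcomes M) (PN : P \in outcomes N) :
  outcomes M = outcomes N -> w M [` PM] = w N [` PN].
Proof.
move=> /measurement_inj MN; case: _ / MN PN => PN.
by congr (w M _); exact: val_inj.
Qed.

Lemma measurement_sumD1 M P : P \in outcomes M ->
  \sum_(Q <- outcomes M `\ P) Q = \1%VF - P.
Proof.
move=> PM.
by rewrite -(measurement_sum M) [in RHS](big_fsetD1 P) //= addrC addrK.
Qed.

(** The outcomes besides [P] sum to [\1 - P]. With one of them, the sum is that outcome and is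
    nonzero; with none, the sum is empty and [P] is the identity. *)
Lemma outcomesD1_small M P : P \in outcomes M -> (#|` outcomes M `\ P| <= 1)%N ->
  outcomes M `\ P = if \1%VF - P == 0 then fset0 else [fset \1%VF - P].
Proof.
move=> PM; rewrite -(measurement_sumD1 PM) leq_eqVlt ltnS leqn0.
case/orP=> [/cardfs1P[Q MP]|]; last first.
  by rewrite cardfs_eq0 => /eqP ->; rewrite big_seq_fset0 eqxx.
have /fsetD1P[_ QM] : Q \in outcomes M `\ P by rewrite MP fset11.
by rewrite MP big_seq_fset1; case: eqP => // /(measurement_neq0 QM).
Qed.

(** An outcome [Q1 + Q2] would either equal [Q1], forcing [Q2 = 0], or be orthogonal to [Q1],
    whereas [Q1 \o (Q1 + Q2) = Q1] is nonzero. *)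
Lemma merge_notin M Q1 Q2 : Q1 \in outcomes M -> Q2 \in outcomes M -> Q1 != Q2 ->
  Q1 + Q2 \notin outcomes M.
Proof.
move=> Q1M Q2M /eqP Q12.
have [[Q11 _] [Q22 _]] := (measurement_oproj Q1M, measurement_oproj Q2M).
have o12 := measurement_orth Q1M Q2M Q12.
apply/negP => QM; have [/eqP Q_eq|/eqP Q_neq] := eqVneq (Q1 + Q2) Q1.
  by case: (measurement_neq0 Q2M); apply: (addrI Q1); rewrite addr0; apply/eqP.
case: (measurement_neq0 Q1M).
by rewrite -(measurement_orth Q1M QM (nesym Q_neq)) comp_lfunDr Q11 o12 addr0.
Qed.

Lemma exists_merge M Q1 Q2 :
  Q1 \in outcomes M -> Q2 \in outcomes M -> Q1 != Q2 ->
  exists N, outcomes N = (Q1 + Q2) |` (outcomes M `\ Q1 `\ Q2).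
Proof.
move=> Q1M Q2M Q12; have Q12n : Q1 <> Q2 by exact/eqP.
have Q21n : Q2 <> Q1 := nesym Q12n.
have oM := @measurement_oproj _ _ _ M; have nM := @measurement_neq0 _ _ _ M.
have orth := @measurement_orth _ _ _ M.
have QM := merge_notin Q1M Q2M Q12.
have restM P : P \in outcomes M `\ Q1 `\ Q2 ->
    [/\ P \in outcomes M, P <> Q1 & P <> Q2].
  by rewrite !in_fsetD1 => /and3P[/eqP ? /eqP ? ?].
pose A := (Q1 + Q2) |` (outcomes M `\ Q1 `\ Q2).
have A_oproj P : P \in A -> is_oproj ip P.
  case/fset1UP=> [->|/restM[/oM]] //.
  by apply: is_oprojD; [exact: oM | exact: oM | exact: orth | exact: orth].
have A_neq0 P : P \in A -> P <> 0.
  case/fset1UP=> [->|/restM[/nM]] // Q0; apply: (nM _ Q1M).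
  have [Q11 _] := oM _ Q1M.
  have : (Q1 \o (Q1 + Q2))%VF = 0 by rewrite Q0 comp_lfun0r.
  by rewrite comp_lfunDr Q11 orth // addr0.
have A_orth P Q : P \in A -> Q \in A -> P <> Q -> (P \o Q)%VF = 0.
  case/fset1UP=> [->|/restM[PM P1 P2]] /fset1UP[->|/restM[QM' QQ1 QQ2]] // PQ.
  - by rewrite comp_lfunDl !orth ?addr0 //; exact: nesym.
  - by rewrite comp_lfunDr !orth ?addr0.
  - exact: orth.
have A_sum : \sum_(P <- A) P = \1%VF.
  (* The merged projection is not already among the remaining outcomes, so the set union loses no
     summand. *)
  rewrite big_fsetU1 /=; last by rewrite !in_fsetD1 (negPf QM) !andbF.
  have Q2M1 : Q2 \in outcomes M `\ Q1 by rewrite in_fsetD1 eq_sym Q12.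
  have sumM := measurement_sumD1 Q1M; rewrite (big_fsetD1 Q2 Q2M1) /= in sumM.
  by rewrite -addrA sumM addrC subrK.
by exists (Measurement A_oproj A_neq0 A_orth A_sum).
Qed.

Lemma merge_complementary_refinement M N P Q1 Q2 :
  P \in outcomes M -> Q1 \in outcomes M `\ P -> Q2 \in outcomes M `\ P ->
  Q1 != Q2 -> outcomes N = (Q1 + Q2) |` (outcomes M `\ Q1 `\ Q2) ->
  complementary_refinement P M N.
Proof.
move=> PM /fsetD1P[Q1P Q1M] /fsetD1P[Q2P Q2M] Q12 N_eq.
have QM := merge_notin Q1M Q2M Q12.
exists (Q1 + Q2); split; last first.
  rewrite in_fsetD1 N_eq in_fset1U !in_fsetD1 PM ![P == _]eq_sym Q1P Q2P.
  rewrite orbT andbT.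
  (* [P] is an outcome of [M] and [Q1 + Q2] is not, so they differ. *)
  by apply: contraNneq QM => ->.
split; first by rewrite N_eq fset1U1.
exists Q1, Q2; split=> //.
- by split; [exact: measurement_oproj Q1M | exact: measurement_oproj Q2M].
- by split; [exact: measurement_neq0 Q1M | exact: measurement_neq0 Q2M].
- exact: measurement_orth Q1M Q2M (elimN eqP Q12).
apply/fsetP => X.
rewrite N_eq in_fsetU in_fset2 in_fsetD1 in_fset1U !in_fsetD1.
have [->|_] := eqVneq X Q1; first by rewrite Q1M /= orbT.
have [->|_] := eqVneq X Q2; first by rewrite Q2M /= !orbT.
(* Splitting discards [Q1 + Q2] from [N]; this agrees with [M] only because [Q1 + Q2] is not an
   outcome of [M]. *)
have [->|_] := eqVneq X (Q1 + Q2); first by rewrite (negPf QM).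
by rewrite /= orbF.
Qed.

(** By induction on the number of outcomes: while two distinct outcomes besides [P] remain, merging
    them lowers this number by one and keeps the weight of [P]. *)
Lemma refinement_consistent_coarsen {w : assignment ip} :
  refinement_consistent w -> forall M P (PM : P \in outcomes M),
  exists N (PN : P \in outcomes N),
    (#|` outcomes N `\ P| <= 1)%N /\ w M [` PM] = w N [` PN].
Proof.
move=> cw M P; have [n] := ubnP #|` outcomes M|.
elim: n M => // n IHn M; rewrite ltnS => Mn PM.
have [small|MP] := leqP #|` outcomes M `\ P| 1; first by exists M, PM.
have /fset0Pn[Q1 Q1MP] : outcomes M `\ P != fset0 by rewrite -cardfs_gt0 ltnW.
have /fset0Pn[Q2 /fsetD1P[Q21 Q2MP]] : outcomes M `\ P `\ Q1 != fset0.
  by move: MP; rewrite (cardfsD1 Q1) Q1MP add1n ltnS cardfs_gt0.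
have Q12 : Q1 != Q2 by rewrite eq_sym.
have [/fsetD1P[_ Q1M] /fsetD1P[_ Q2M]] := (Q1MP, Q2MP).
have [N N_eq] := exists_merge Q1M Q2M Q12.
have ref := merge_complementary_refinement PM Q1MP Q2MP Q12 N_eq.
have PN : P \in outcomes N by have [Q [_ /fsetD1P[]]] := ref.
have NM : (#|` outcomes N| < #|` outcomes M|)%N.
  rewrite N_eq cardfsU1 !in_fsetD1 (negPf (merge_notin Q1M Q2M Q12)) !andbF /=.
  have cardM : #|` outcomes M| = #|` outcomes M `\ Q1 `\ Q2|.+2.
    rewrite [LHS](cardfsD1 Q1) Q1M add1n; congr _.+1.
    by rewrite [LHS](cardfsD1 Q2) in_fsetD1 Q21 Q2M.
  by rewrite add1n [ltnRHS]cardM.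
have [N' [PN' [small eqw]]] := IHn N (leq_trans NM Mn) PN.
by exists N', PN'; split; rewrite // -eqw; exact: cw ref PM PN.
Qed.

End Measurements.

Theorem theorem5p3 (R : realType) (H : vectType R[i])
    (ip : {dot H for @conjC R[i]}) (dimH : (2 <= \dim {: H})%N)
    (w : assignment ip) :
  context_independent w <-> refinement_consistent w.
Proof.
split=> [cw M' M P _ PM' PM|cw M N P PM PN]; first exact: cw.
have [M' [PM' [smallM ->]]] := refinement_consistent_coarsen cw PM.
have [N' [PN' [smallN ->]]] := refinement_consistent_coarsen cw PN.
(* Each outcome set is [P] together with a remainder that is a function of [P] alone, so the two
   sets coincide. *)
apply: eq_assignment; rewrite -[LHS](fsetD1K PM') -[RHS](fsetD1K PN').
by rewrite (outcomesD1_small PM' smallM) (outcomesD1_small PN' smallN).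
Qed.
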